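(* Let $F$ be the free commutative radical ring on a one-element set $\{x\}$. Then the sub-skew brace $I$ of $F$ generated by $\{x+x,\ x\circ x\}$ is not a free commutative radical ring (on any set).
   Context: A commutative radical ring is a commutative (non-unital) ring $R$ with $J(R)=R$, i.e. such that $R$ is a group under $a\circ b=a+ab+b$. Equivalently, it is a skew brace $(R,+,\circ)$ (two groups on the same set with $a\circ(b+c)=a\circ b-a+a\circ c$) in which both $(R,+)$ and $(R,\circ)$ are abelian, the ring product being $a*b=-a+a\circ b-b$. A sub-skew brace is a subset that is a subgroup of both $(R,+)$ and $(R,\circ)$ (it is again a commutative radical ring). Free commutative radical rings are the free objects in the category of commutative radical rings. The free commutative radical ring on a set $X$ can be realised as $\{\frac{f}{1+g}\mid f,g\in\langle X\rangle_{id}\}\subset\mathbb Q(X)$ with the usual addition and multiplication of rational functions, where $\langle X\rangle_{id}$ is the ideal of $\mathbb Z[X]$ generated by the commuting variables $X$. *)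

(* Defs.v *)
From HB Require Import structures.
From mathcomp Require Import all_boot all_algebra.
From mathcomp Require Import boolp classical_sets.

Set Implicit Arguments.
Unset Strict Implicit.
Unset Printing Implicit Defensive.

Import GRing.Theory.

Local Open Scope ring_scope.
Local Open Scope classical_set_scope.

(* MathComp has no non-unital rings, hence a separate structure on top of
   zmodType.  [cinv] is the inverse for the adjoint (circle) operation
   a + ab + b; it is uniquely determined by the ring.  The eqType and choiceType
   structures included in zmodType are no restriction in classical logic. *)
HB.mixin Record Zmodule_isComRadicalRing R of GRing.Zmodule R := {
  rmul : R -> R -> R;
  cinv : R -> R;
  rmulA : forall a b c, rmul a (rmul b c) = rmul (rmul a b) c;
  rmulC : forall a b, rmul a b = rmul b a;
  rmulDl : forall a b c, rmul (a + b) c = rmul a c + rmul b c;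
  add_rmul_cinv : forall a, a + rmul a (cinv a) + cinv a = 0
}.

#[short(type="comRadicalRingType")]
HB.structure Definition ComRadicalRing :=
  {R of GRing.Zmodule R & Zmodule_isComRadicalRing R}.

Section Circle.
Variable R : comRadicalRingType.
Implicit Types a b c : R.

Definition circ a b : R := a + rmul a b + b.

Lemma rmulDr a b c : rmul a (b + c) = rmul a b + rmul a c.
Proof. by rewrite rmulC rmulDl !(rmulC a). Qed.

Lemma rmul0r a : rmul 0 a = 0.
Proof. by apply: (@addrI _ (rmul 0 a)); rewrite -rmulDl !addr0. Qed.

Lemma circC a b : circ a b = circ b a.
Proof. by rewrite /circ rmulC addrAC [RHS]addrAC (addrC a). Qed.

Lemma circA a b c : circ a (circ b c) = circ (circ a b) c.
Proof.
rewrite /circ !rmulDr !rmulDl rmulA !addrA.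
by rewrite [LHS](ACl (1*2*5*4*3*6*7)).
Qed.

Lemma circ0a a : circ 0 a = a.
Proof. by rewrite /circ rmul0r !add0r. Qed.

Lemma circaV a : circ a (cinv a) = 0.
Proof. exact: add_rmul_cinv. Qed.

Lemma rmulE a b : rmul a b = - a + circ a b - b.
Proof. by rewrite /circ !addrA addNr add0r addrK. Qed.

Lemma circDr a b c : circ a (b + c) = circ a b - a + circ a c.
Proof.
rewrite /circ rmulDr !addrA.
by rewrite [RHS](ACl ((1*4)*5*2*6*3*7)) /= addrN add0r.
Qed.

End Circle.

(* The neutral element of the adjoint group is 0. *)
Record sub_skew_brace (R : comRadicalRingType) (S : set R) : Prop := {
  ssb0 : S 0;
  ssbD : forall a b, S a -> S b -> S (a + b);
  ssbN : forall a, S a -> S (- a);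
  ssb_circ : forall a b, S a -> S b -> S (circ a b);
  ssb_cinv : forall a, S a -> S (cinv a)
}.

Record subSkewBrace (R : comRadicalRingType) := SubSkewBrace {
  ssb_set : set R;
  ssbP : sub_skew_brace ssb_set
}.

(* A sub-skew brace is itself a commutative radical ring. *)
Section SubRing.
Variables (R : comRadicalRingType) (S : subSkewBrace R).

Definition in_ssb : pred R := fun a => a \in ssb_set S.

Lemma in_ssb_zmod_closed : zmod_closed in_ssb.
Proof.
have [S0 SD SN _ _] := ssbP S; split => [|a b]; rewrite /in_ssb ?unfold_in /=.
  exact: mem_set.
by move=> /set_mem Sa /set_mem Sb; apply/mem_set/SD => //; apply: SN.
Qed.

HB.instance Definition _ := GRing.isZmodClosed.Build R in_ssb in_ssb_zmod_closed.

Definition ssb_type : Type := {a : R | in_ssb a}.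

HB.instance Definition _ := Choice.on ssb_type.
HB.instance Definition _ := SubType.on ssb_type.
HB.instance Definition _ := [SubChoice_isSubZmodule of ssb_type by <:].

Implicit Types u v w : ssb_type.

Lemma in_ssb_rmul u v : in_ssb (rmul (val u) (val v)).
Proof.
have [_ SD SN SC _] := ssbP S.
have /set_mem Su := valP u; have /set_mem Sv := valP v.
by rewrite rmulE; apply/mem_set/SD; [apply: SD|]; auto.
Qed.

Lemma in_ssb_cinv u : in_ssb (cinv (val u)).
Proof. by apply/mem_set/(ssb_cinv (ssbP S))/set_mem/(valP u). Qed.

Definition ssb_rmul u v : ssb_type := Sub (rmul (val u) (val v)) (in_ssb_rmul u v).
Definition ssb_cinvop u : ssb_type := Sub (cinv (val u)) (in_ssb_cinv u).

Lemma ssb_rmulA u v w : ssb_rmul u (ssb_rmul v w) = ssb_rmul (ssb_rmul u v) w.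
Proof. by apply: val_inj; rewrite /= rmulA. Qed.

Lemma ssb_rmulC u v : ssb_rmul u v = ssb_rmul v u.
Proof. by apply: val_inj; rewrite /= rmulC. Qed.

Lemma ssb_rmulDl u v w :
  ssb_rmul (u + v) w = ssb_rmul u w + ssb_rmul v w.
Proof. by apply: val_inj; rewrite /= rmulDl. Qed.

Lemma ssb_add_rmul_cinv u : u + ssb_rmul u (ssb_cinvop u) + ssb_cinvop u = 0.
Proof. by apply: val_inj; rewrite /= add_rmul_cinv. Qed.

HB.instance Definition _ := Zmodule_isComRadicalRing.Build ssb_type
  ssb_rmulA ssb_rmulC ssb_rmulDl ssb_add_rmul_cinv.

End SubRing.

Coercion ssb_type : subSkewBrace >-> Sortclass.

Lemma smallest_sub_skew_brace (R : comRadicalRingType) (A : set R) :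
  sub_skew_brace (smallest (@sub_skew_brace R) A).
Proof.
split=> [S [Ss _]|a b Ha Hb S SA|a Ha S SA|a b Ha Hb S SA|a Ha S SA].
- exact: ssb0.
- by apply: (ssbD SA.1); [apply: Ha|apply: Hb].
- by apply: (ssbN SA.1); apply: Ha.
- by apply: (ssb_circ SA.1); [apply: Ha|apply: Hb].
- by apply: (ssb_cinv SA.1); apply: Ha.
Qed.

Definition ssb_generated (R : comRadicalRingType) (A : set R) : subSkewBrace R :=
  SubSkewBrace (smallest_sub_skew_brace A).

Record crr_hom (R R' : comRadicalRingType) (f : R -> R') : Prop := {
  crr_homD : forall a b, f (a + b) = f a + f b;
  crr_homM : forall a b, f (rmul a b) = rmul (f a) (f b)
}.

(* [F] is free on [X] via [i : X -> F] (injectivity of [i] is a consequence). *)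
Definition free_on (X : Type) (F : comRadicalRingType) (i : X -> F) : Prop :=
  forall (R : comRadicalRingType) (r : X -> R),
    exists! f : F -> R, crr_hom f /\ forall t, f (i t) = r t.

(* Main.v *)
Require Import Defs.
From HB Require Import structures.
From mathcomp Require Import all_boot all_algebra.
From mathcomp Require Import boolp classical_sets.
From mathcomp Require Import ring.

Import GRing.Theory Num.Theory.

Local Open Scope ring_scope.
Local Open Scope classical_set_scope.

(** Put u = 2x and v = x^2 in I, so that u * u = 4v.  If I were free on X, every
    homomorphism from I to Z/2 with zero product would lift, through X, to a
    homomorphism f from I to Z with zero product; then 4 f(v) = f(u) f(u) = 0, so
    every such homomorphism would kill v.  But modulo x^3 the elements of I have the
    form 2a x + b x^2, with products 4ac x^2, so b mod 2 is such a homomorphism, and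
    it sends v to 1. *)

(** A separate name keeps the zero product apart from any other product on [V]; the adjoint
    operation is then addition itself. *)
Definition null_ring (V : zmodType) : Type := V.

Section NullRing.
Variable V : zmodType.

HB.instance Definition _ := GRing.Zmodule.on (null_ring V).

Definition null_rmul (a b : null_ring V) : null_ring V := 0.

Lemma null_rmulA a b c : null_rmul a (null_rmul b c) = null_rmul (null_rmul a b) c.
Proof. by []. Qed.

Lemma null_rmulC a b : null_rmul a b = null_rmul b a.
Proof. by []. Qed.

Lemma null_rmulDl a b c : null_rmul (a + b) c = null_rmul a c + null_rmul b c.
Proof. by rewrite /null_rmul addr0. Qed.

Lemma null_add_rmul_cinv (a : null_ring V) : a + null_rmul a (- a) + - a = 0.
Proof. by rewrite /null_rmul addr0 subrr. Qed.

HB.instance Definition _ := Zmodule_isComRadicalRing.Build (null_ring V)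
  null_rmulA null_rmulC null_rmulDl null_add_rmul_cinv.

End NullRing.

Section Hom.
Variables (R R' : comRadicalRingType) (f : R -> R').
Hypothesis hf : crr_hom f.

Lemma crr_hom0 : f 0 = 0.
Proof. by apply: (addrI (f 0)); rewrite -(crr_homD hf) !addr0. Qed.

Lemma crr_homN a : f (- a) = - f a.
Proof. by apply: (addrI (f a)); rewrite -(crr_homD hf) !subrr crr_hom0. Qed.

Lemma crr_homMn a n : f (a *+ n) = f a *+ n.
Proof.
by elim: n => [|n IHn]; rewrite ?mulr0n ?crr_hom0 // !mulrS (crr_homD hf) IHn.
Qed.

Lemma crr_hom_circ a b : f (circ a b) = circ (f a) (f b).
Proof. by rewrite /circ !(crr_homD hf) (crr_homM hf). Qed.

(** Inverses in the adjoint group are unique, so preserving sum and product is enough. *)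
Lemma crr_hom_cinv a : f (cinv a) = cinv (f a).
Proof.
rewrite -[LHS]circ0a -(circaV (f a)) (circC (f a)) -circA -crr_hom_circ circaV.
by rewrite crr_hom0 circC circ0a.
Qed.

Lemma sub_skew_brace_preim (S : set R') :
  sub_skew_brace S -> sub_skew_brace (f @^-1` S).
Proof.
move=> [S0 SD SN SC SV]; split=> [|a b|a|a b|a] /=.
- by rewrite crr_hom0.
- by rewrite (crr_homD hf); apply: SD.
- by rewrite crr_homN; apply: SN.
- by rewrite crr_hom_circ; apply: SC.
- by rewrite crr_hom_cinv; apply: SV.
Qed.

End Hom.

(** The pair (a, b) stands for a x + b x^2 in x Z[x] / (x^3). *)
Definition trunc3 : Type := (int * int)%type.

HB.instance Definition _ := GRing.Zmodule.on trunc3.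

Definition trunc3_mul (a b : trunc3) : trunc3 := (0, a.1 * b.1).
(** This is 1/(1 + t) - 1 = -t + t^2 modulo x^3, for t = a.1 x + a.2 x^2. *)
Definition trunc3_cinv (a : trunc3) : trunc3 := (- a.1, a.1 ^+ 2 - a.2).

Lemma trunc3_mulA a b c : trunc3_mul a (trunc3_mul b c) = trunc3_mul (trunc3_mul a b) c.
Proof. by rewrite /trunc3_mul /= mulr0 mul0r. Qed.

Lemma trunc3_mulC a b : trunc3_mul a b = trunc3_mul b a.
Proof. by rewrite /trunc3_mul mulrC. Qed.

Lemma trunc3_mulDl a b c : trunc3_mul (a + b) c = trunc3_mul a c + trunc3_mul b c.
Proof. by congr pair; rewrite /= ?addr0 ?mulrDl. Qed.

Lemma trunc3_add_mul_cinv a : a + trunc3_mul a (trunc3_cinv a) + trunc3_cinv a = 0.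
Proof. by case: a => a b; congr pair => /=; ring. Qed.

HB.instance Definition _ := Zmodule_isComRadicalRing.Build trunc3
  trunc3_mulA trunc3_mulC trunc3_mulDl trunc3_add_mul_cinv.

Definition even_linear_part : set trunc3 := [set a | (a.1)%:~R = 0 :> 'Z_2].

Lemma even_linear_part_ssb : sub_skew_brace even_linear_part.
Proof.
rewrite /even_linear_part; split=> [|a b|a|a b|a] //=.
- by move=> a0 b0; rewrite rmorphD /= a0 b0 addr0.
- by move=> a0; rewrite rmorphN /= a0 oppr0.
- by move=> a0 b0; rewrite addr0 rmorphD /= a0 b0 addr0.
- by move=> a0; rewrite rmorphN /= a0 oppr0.
Qed.

Lemma free_null_torsion (X : Type) (R : comRadicalRingType) (i : X -> R)
    (h : R -> null_ring 'Z_2) (u v : R) (n : nat) :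
  free_on i -> crr_hom h -> v *+ n.+1 = rmul u u -> h v = 0.
Proof.
move=> free_i hh vu.
(* The representatives 0 and 1 lift [h] on the generators; freeness extends them to [f]. *)
pose r t : null_ring int := (nat_of_ord (h (i t)))%:Z.
have [f [[hf fi] _]] := free_i _ r.
have fv0 : f v = 0.
  have /eqP : f v *+ n.+1 = 0 by rewrite -(crr_homMn _ _ _ hf) vu (crr_homM hf).
  by rewrite mulrn_eq0 /= => /eqP.
pose g a : null_ring 'Z_2 := (f a : int)%:~R.
have hg : crr_hom g.
  split=> a b; rewrite /g; first by rewrite (crr_homD hf) rmorphD.
  by rewrite (crr_homM hf).
have gi t : g (i t) = h (i t) by rewrite /g fi /r -pmulrn; apply: natr_Zp.
(* Both [g], the reduction of [f] mod 2, and [h] extend [h \o i], so uniqueness identifies them. *)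
have [k [_ uniq_k]] := free_i _ (h \o i).
have <- : g = h.
  by rewrite -(uniq_k g (conj hg gi)); apply: uniq_k; split.
by rewrite /g fv0.
Qed.

Theorem proposition8p9 (F : comRadicalRingType) (x : F)
    (hF : free_on (fun _ : unit => x)) :
  let I := ssb_generated [set x + x; circ x x] in
  ~ exists (X : Type) (i : X -> I), free_on i.
Proof.
move=> I [X [i free_i]].
(* Sending x to [(1, 0)] makes [g] the reduction modulo x^3. *)
have [g [[hg gx] _]] := hF trunc3 (fun=> (1, 0)).
have {}gx := gx tt.
have even_g (a : I) : even_linear_part (g (val a)).
  have /set_mem Ia := valP a.
  (* The generated sub-skew brace lies in every sub-skew brace containing the generators, here a
     preimage under [g]. *)
  apply: (Ia (g @^-1` even_linear_part)); split.
    exact: (sub_skew_brace_preim _ _ _ hg _ even_linear_part_ssb).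
  (* The generators map to [(2, 0)] and [(2, 1)]. *)
  move=> _ [->|->]; rewrite /preimage /even_linear_part /=.
    by rewrite (crr_homD hg) gx; apply: val_inj.
  by rewrite (crr_hom_circ _ _ _ hg) gx; apply: val_inj.
pose h (a : I) : null_ring 'Z_2 := ((g (val a)).2)%:~R.
have hh : crr_hom h.
  split=> a b; rewrite /h /=; first by rewrite (crr_homD hg) rmorphD.
  by rewrite (crr_homM hg) /= rmorphM /= (even_g a) mul0r.
have Iu : in_ssb I (x + x) by apply/mem_set => S [_]; apply; left.
have Ic : in_ssb I (circ x x) by apply/mem_set => S [_]; apply; right.
pose u : I := Sub (x + x) Iu.
pose v : I := Sub (circ x x) Ic - u.
have valv : val v = rmul x x.
  by rewrite /= /circ opprD addrA addrAC (addrAC x) subrr add0r addrK.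
have vu : v *+ 4 = rmul u u.
  apply: val_inj; transitivity (val v *+ 4); first exact: raddfMn.
  rewrite valv /= rmulDl !rmulDr.
  by rewrite !mulrS mulr0n addr0 !addrA.
(* This gives [h v = 0], whereas [g] sends x^2 to [(0, 1)], so [h v] is 1 in ['Z_2]. *)
have := free_null_torsion _ _ _ _ _ _ _ free_i hh vu.
by rewrite /h valv (crr_homM hg) gx.
Qed.
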